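(* Let $n\ge 1$ and let $\mathcal{S}_n\subseteq\mathcal{M}_n$ be the family of $n\times n$ complex scalar matrices. Then $\mathcal{S}_n$ and $\mathcal{M}_n$ form an additive finite free complementary pair, i.e. $\mathcal{S}_n^{\boxplus}=\mathcal{M}_n$ and $\mathcal{M}_n^{\boxplus}=\mathcal{S}_n$.
   Context: $\mathcal{M}_n=\mathbb{C}^{n\times n}$ and $\chi_A(x)=\det(xI-A)$. A scalar matrix is a matrix $\lambda I$ with $\lambda\in\mathbb{C}$. For polynomials $p(x)=\sum_{k=0}^n a_kx^{n-k}$ and $q(x)=\sum_{k=0}^n b_kx^{n-k}$ of degree $n$ over $\mathbb{C}$, the additive convolution is $p(x)\boxplus q(x)=\sum_{k=0}^n\Big(\sum_{i+j=k}\frac{\binom{n-i}{j}}{\binom{n}{j}}a_ib_j\Big)x^{n-k}$. Matrices $A,B\in\mathcal{M}_n$ are in additive finite free position (additive FFP) if $\chi_{A+B}(x)=\chi_A(x)\boxplus\chi_B(x)$. For $\mathcal{A}\subseteq\mathcal{M}_n$, $\mathcal{A}^{\boxplus}$ is the set of all $B\in\mathcal{M}_n$ that are in additive FFP with every $A\in\mathcal{A}$. Sets $\mathcal{V},\mathcal{W}\subseteq\mathcal{M}_n$ form an additive finite free complementary pair if $\mathcal{V}^{\boxplus}=\mathcal{W}$ and $\mathcal{W}^{\boxplus}=\mathcal{V}$. *)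

(* Defs.v *)
From HB Require Import structures.
From mathcomp Require Import all_boot all_order all_algebra.
From mathcomp Require Import classical_sets reals.
From mathcomp Require Import complex.

Set Implicit Arguments.
Unset Strict Implicit.
Unset Printing Implicit Defensive.

Import GRing.Theory.
Local Open Scope ring_scope.
Local Open Scope classical_set_scope.
Local Open Scope complex_scope.

(* The field of complex numbers is [R[i]] for [R : realType].
   The convolution depends on [n] and is meant for [p] and [q] of degree [n].
   Coefficients are numbered from the top: [a_i] is [p`_(n - i)]. *)
Definition add_conv (R : realType) (n : nat) (p q : {poly R[i]}) :
    {poly R[i]} :=
  \sum_(k < n.+1)
    (\sum_(i < n.+1) \sum_(j < n.+1 | (i + j == k)%N)
        'C(n - i, j)%:R / 'C(n, j)%:R * p`_(n - i) * q`_(n - j))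
    *: 'X^(n - k).

Definition additive_FFP (R : realType) (n : nat) (A B : 'M[R[i]]_n) : Prop :=
  char_poly (A + B) = add_conv n (char_poly A) (char_poly B).

Definition add_ffp_compl (R : realType) (n : nat) (V : set 'M[R[i]]_n) :
    set 'M[R[i]]_n :=
  [set B | forall A, V A -> additive_FFP A B].

Definition additive_FFC_pair (R : realType) (n : nat)
    (V W : set 'M[R[i]]_n) : Prop :=
  add_ffp_compl V = W /\ add_ffp_compl W = V.

Definition scalar_matrices (R : realType) (n : nat) : set 'M[R[i]]_n :=
  [set A | exists l : R[i], A = l%:M].

Arguments scalar_matrices R n : clear implicits.

(* Main.v *)
Require Import Defs.
From mathcomp Require Import all_boot all_order all_algebra.
From mathcomp Require Import classical_sets reals.
From mathcomp Require Import complex.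
From mathcomp Require Import ring.

(** A scalar matrix [l%:M] and an arbitrary matrix [B] are in additive FFP,
    because both sides of the defining equation are the translate [char_poly B
    \Po ('X - l%:P)]: on the left by the definition of the characteristic
    polynomial, on the right by the binomial theorem applied to [char_poly
    l%:M = ('X - l%:P) ^+ n]. The convolution is symmetric, so the order of
    the two matrices does not matter. This leaves one nontrivial inclusion: a
    matrix in additive FFP with every matrix is scalar.

    Let [B] be in additive FFP with every matrix. Taking [l = 0] above shows
    that convolving with ['X^n] changes nothing, so adding to [B] a matrix of
    characteristic polynomial ['X^n] must preserve the characteristic
    polynomial. Apply this to the nilpotent matrix units [delta_mx i j], [i !=
    j]. A determinant is affine in each entry, with slope the cofactor, hence
    all off-diagonal cofactors of [xI - B] vanish: its adjugate is diagonal,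
    and then so is [B] ([diag_of_cofactor_char_poly_mx]). The hypothesis on
    [B] is invariant under similarity, so every conjugate of [B] is diagonal
    as well. Conjugating by the transvection [1 + delta_mx i j] puts the
    difference of two diagonal entries of [B] off the diagonal, so these
    entries agree and [B] is scalar. *)

Set Implicit Arguments.
Unset Strict Implicit.
Unset Printing Implicit Defensive.

Import GRing.Theory Num.Theory.
Local Open Scope ring_scope.

Local Open Scope classical_set_scope.
Local Open Scope complex_scope.

(** * The additive convolution *)

(** Both sides are the multinomial [n! / (i! j! (n - i - j)!)], or [0] when
    [n < i + j]. *)
Lemma mul_bin_subC (n i j : nat) : (i <= n)%N -> (j <= n)%N ->
  ('C(n - i, j) * 'C(n, i) = 'C(n - j, i) * 'C(n, j))%N.
Proof.
move=> le_in le_jn; case: (leqP (i + j) n) => [le_ijn|lt_nij]; last first.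
  by rewrite (@bin_small (n - i)) ?(@bin_small (n - j)) ?ltn_subLR // addnC.
have fact3 a b : (a <= n)%N -> (a + b <= n)%N ->
    ('C(n - a, b) * 'C(n, a) * (a`! * b`! * (n - (a + b))`!) = n`!)%N.
  move=> le_an le_abn; rewrite -(bin_fact le_an).
  have le_b : (b <= n - a)%N by rewrite leq_subRL.
  by rewrite -(bin_fact le_b) subnDA; ring.
have := fact3 i j le_in le_ijn.
rewrite -(fact3 j i le_jn); last by rewrite addnC.
rewrite (addnC j i) (mulnC j`!) => /eqP.
by rewrite eqn_pmul2r ?muln_gt0 ?fact_gt0 // => /eqP.
Qed.

(** The definition with the inner index sums freed from [i + j = k]; the terms
    with [n < i + j] are absorbed because their coefficient ['C(n - i, j)]
    vanishes. *)
Lemma add_convE (R : realType) (n : nat) (p q : {poly R[i]}) :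
  add_conv n p q = \sum_(j < n.+1) \sum_(i < n.+1)
    ('C(n - i, j)%:R / 'C(n, j)%:R * p`_(n - i) * q`_(n - j))
      *: 'X^(n - (i + j)).
Proof.
rewrite exchange_big /= /add_conv.
transitivity (\sum_(k < n.+1) \sum_(i < n.+1) \sum_(j < n.+1 | (i + j == k)%N)
    ('C(n - i, j)%:R / 'C(n, j)%:R * p`_(n - i) * q`_(n - j)) *: 'X^(n - k)).
  apply: eq_bigr => k _; rewrite scaler_suml.
  by apply: eq_bigr => i _; rewrite scaler_suml.
rewrite exchange_big /=; apply: eq_bigr => i _.
rewrite (exchange_big_dep predT) //=; apply: eq_bigr => j _.
case: (leqP (i + j) n) => [le_ijn|lt_nij].
  by rewrite (big_pred1 (Ordinal (le_ijn : i + j < n.+1)%N)).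
rewrite bin_small ?ltn_subLR -1?ltnS // !mul0r scale0r.
by apply: big1 => k _; rewrite scale0r.
Qed.

Lemma add_convC (R : realType) (n : nat) (p q : {poly R[i]}) :
  add_conv n p q = add_conv n q p.
Proof.
rewrite !add_convE exchange_big /=; apply: eq_bigr => i _.
apply: eq_bigr => j _; rewrite addnC -!mulrA (mulrC p`_ _) !mulrA.
congr (_ * _ * _ *: _); have [lei lej] := (ltn_ord i, ltn_ord j).
apply/eqP; rewrite eqr_div ?pnatr_eq0 -?lt0n ?bin_gt0 //.
by rewrite -!natrM mul_bin_subC.
Qed.

(** Convolving with the [n]-th power of a linear polynomial is a translation:
    this is the binomial theorem, read coefficientwise. *)
Lemma add_conv_XsubC_exp (R : realType) (n : nat) (l : R[i]) (q : {poly R[i]}) :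
  (size q <= n.+1)%N -> add_conv n (('X - l%:P) ^+ n) q = q \Po ('X - l%:P).
Proof.
move=> size_q; rewrite add_convE.
have coef_XsubC i : (i <= n)%N ->
    (('X - l%:P) ^+ n)`_(n - i) = (- l) ^+ i *+ 'C(n, i).
  move=> le_in; rewrite exprDn coef_sum (bigD1 (Ordinal (le_in : i < n.+1)%N)) //=.
  rewrite big1 ?addr0 => [|k /negP ne_ki]; rewrite coefMn -polyCN -polyC_exp.
    by rewrite coefMC coefXn eqxx mul1r.
  rewrite coefMC coefXn; case: eqP => [eq_sub|_]; last by rewrite mul0r mul0rn.
  case: ne_ki; apply/eqP/val_inj => /=.
  by rewrite -(subKn le_in) eq_sub subKn // -ltnS.
have q_sum : q = \sum_(j < n.+1) q`_(n - j) *: 'X^(n - j).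
  rewrite (reindex_inj rev_ord_inj) /=.
  under eq_bigr => j _ do rewrite subSS subKn -1?ltnS //.
  rewrite -(poly_def n.+1 (fun j => q`_j)); apply/polyP => k; rewrite coef_poly.
  by case: ltnP => // lenk; rewrite nth_default // (leq_trans size_q).
rewrite [q in RHS]q_sum [RHS]raddf_sum /=; apply: eq_bigr => j _.
have le_jn : (j <= n)%N by rewrite -ltnS.
have bin_neq0 : 'C(n, j)%:R != 0 :> R[i] by rewrite pnatr_eq0 -lt0n bin_gt0.
rewrite comp_polyZ rmorphXn /= comp_polyX [X in _ = _ *: X]exprDn scaler_sumr.
(* Pad the binomial expansion with zeros up to [n], to match the range of [i]
   on the left. *)
rewrite [RHS](big_ord_widen n.+1 (fun i => q`_(n - j) *:
  ('X^(n - j - i) * (- l%:P) ^+ i *+ 'C(n - j, i)))) ?ltnS ?leq_subr //.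
rewrite [RHS]big_mkcond; apply: eq_bigr => i _ /=.
have le_in : (i <= n)%N by rewrite -ltnS.
rewrite coef_XsubC // ltnS; case: (leqP i (n - j)) => [le_i|lt_i]; last first.
  have lt_j : (n - i < j)%N by rewrite ltn_subLR // addnC -ltn_subLR.
  by rewrite (bin_small lt_j) !mul0r scale0r.
rewrite addnC subnDA -polyCN -polyC_exp [_ * _%:P]mulrC mul_polyC scalerMnl scalerA.
have bin_eq : 'C(n - i, j)%:R / 'C(n, j)%:R * 'C(n, i)%:R = 'C(n - j, i)%:R :> R[i].
  by rewrite mulrAC -natrM mul_bin_subC // natrM mulfK.
congr (_ *: _); rewrite -[_ *+ 'C(n, i)]mulr_natl mulrA bin_eq.
by rewrite mulrC mulr_natl.
Qed.

(** * Characteristic polynomials *)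

Lemma char_poly_scalar_add (F : comNzRingType) n (l : F) (B : 'M[F]_n) :
  char_poly (l%:M + B) = char_poly B \Po ('X - l%:P).
Proof.
rewrite /char_poly -det_map_mx; congr (\det _); apply/matrixP => i j.
rewrite !mxE [RHS]raddfB /= raddfMn /= comp_polyX comp_polyC.
by rewrite polyCD polyCMn opprD addrA mulrnBl.
Qed.

Lemma char_poly_scalar (F : comNzRingType) n (l : F) :
  char_poly (l%:M : 'M_n) = ('X - l%:P) ^+ n.
Proof. by rewrite /char_poly /char_poly_mx map_scalar_mx -raddfB det_scalar. Qed.

(** The cofactors along row [i] do not see the entries of that row, so the
    Laplace expansion along it is affine in each of them. *)
Lemma det_add_delta (F : comNzRingType) n (A : 'M[F]_n) (a : F) (i j : 'I_n) :
  \det (A + a *: delta_mx i j) = \det A + a * cofactor A i j.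
Proof.
have cof k : cofactor (A + a *: delta_mx i j) i k = cofactor A i k.
  congr (_ * \det _); apply/matrixP => u v.
  by rewrite !mxE eq_sym (negPf (neq_lift _ _)) mulr0 addr0.
rewrite !(expand_det_row _ i).
under eq_bigr => k _ do rewrite cof !mxE eqxx mulrDl.
rewrite big_split /=; congr (_ + _).
rewrite (bigD1 j) //= eqxx mulr1 big1 ?addr0 // => k /negPf ->.
by rewrite mulr0 mul0r.
Qed.

Lemma char_poly_add_delta (F : comNzRingType) n (B : 'M[F]_n) (i j : 'I_n) :
  char_poly (delta_mx i j + B) = char_poly B - cofactor (char_poly_mx B) i j.
Proof.
rewrite -mulN1r -det_add_delta; congr (\det _).
rewrite scaleN1r /char_poly_mx map_mxD /= map_delta_mx.
by rewrite opprD addrA addrAC.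
Qed.

(** The cofactors of [xI] are read off [xI * adj (xI) = x^n I], which spares
    distinguishing lower from upper triangular matrix units. *)
Lemma char_poly_delta (F : idomainType) n (i j : 'I_n) : i != j ->
  char_poly (delta_mx i j : 'M[F]_n) = 'X^n.
Proof.
move=> ne_ij; rewrite -[delta_mx i j]addr0 char_poly_add_delta.
have -> : char_poly (0 : 'M[F]_n) = 'X^n.
  by rewrite -(raddf0 (@scalar_mx F n)) char_poly_scalar polyC0 subr0.
suff -> : cofactor (char_poly_mx 0) i j = 0 :> {poly F} by rewrite subr0.
have := congr1 (fun M : 'M__ => M j i) (mul_mx_adj ('X%:M : 'M[{poly F}]_n)).
rewrite mul_scalar_mx !mxE eq_sym (negPf ne_ij) => /eqP.
by rewrite mulf_eq0 polyX_eq0 /char_poly_mx map_mx0 subr0 => /eqP.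
Qed.

(** If the adjugate of [M = xI - B] is diagonal, the off-diagonal entry [(i, j)]
    of [M * adj M = (det M) I] reads [M i j * adj M j j = 0], while the entry
    [(j, j)] shows that [adj M j j] divides [char_poly B != 0]. *)
Lemma diag_of_cofactor_char_poly_mx (F : idomainType) n (B : 'M[F]_n) :
  (forall i j, i != j -> cofactor (char_poly_mx B) i j = 0) ->
  forall i j, i != j -> B i j = 0.
Proof.
move=> cof0 i j ne_ij; set M := char_poly_mx B in cof0.
have entry k : M k j * cofactor M j j = char_poly B *+ (k == j).
  have := congr1 (fun N : 'M__ => N k j) (mul_mx_adj M).
  rewrite [LHS]mxE [RHS]mxE (bigD1 j) //= [\adj M j j]mxE big1 ?addr0 // => u ne_uj.
  by rewrite [\adj M u j]mxE cof0 ?mulr0 // eq_sym.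
have cof_neq0 : cofactor M j j != 0.
  apply/eqP => cofj0; have := monic_neq0 (char_poly_monic B).
  by move: (entry j); rewrite cofj0 mulr0 eqxx mulr1n => <-; rewrite eqxx.
have /eqP := entry i; rewrite (negPf ne_ij) mulf_eq0 (negPf cof_neq0) orbF.
by rewrite !mxE (negPf ne_ij) sub0r oppr_eq0 polyC_eq0 => /eqP.
Qed.

Lemma char_poly_conj (F : comNzRingType) n (P Q A : 'M[F]_n) :
  P *m Q = 1%:M -> char_poly (P *m A *m Q) = char_poly A.
Proof.
move=> PQ; have PQ' : map_mx polyC P *m map_mx polyC Q = 1%:M.
  by rewrite -map_mxM PQ map_mx1.
have -> : char_poly (P *m A *m Q) =
    \det (map_mx polyC P *m char_poly_mx A *m map_mx polyC Q).
  congr (\det _); rewrite /char_poly_mx mulmxBr mulmxBl !map_mxM /=.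
  by rewrite scalar_mxC -[_%:M *m _ *m _]mulmxA PQ' mulmx1.
by rewrite !det_mulmx mulrAC -det_mulmx PQ' det1 mul1r.
Qed.

(** * Matrices in free position with everything *)

Lemma additive_FFP_scalar (R : realType) n (l : R[i]) (B : 'M_n) :
  additive_FFP l%:M B.
Proof.
rewrite /additive_FFP char_poly_scalar_add char_poly_scalar.
by rewrite add_conv_XsubC_exp ?size_char_poly.
Qed.

Lemma additive_FFP_sym (R : realType) n (A B : 'M[R[i]]_n) :
  additive_FFP A B -> additive_FFP B A.
Proof. by move=> ffpAB; rewrite /additive_FFP addrC add_convC. Qed.

(** Convolution with ['X^n], the characteristic polynomial of the nilpotent
    [delta_mx i j], is the identity, so the cofactor by which this matrix
    changes [char_poly B] must vanish. *)
Lemma add_ffp_compl_setT_diag (R : realType) n (B : 'M[R[i]]_n) :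
  add_ffp_compl setT B -> forall i j, i != j -> B i j = 0.
Proof.
move=> ffpB; apply: diag_of_cofactor_char_poly_mx => i j ne_ij.
have := ffpB (delta_mx i j) I; rewrite /additive_FFP char_poly_delta //.
rewrite -['X]subr0 -polyC0 add_conv_XsubC_exp ?size_char_poly //.
rewrite subr0 comp_polyXr char_poly_add_delta => /eqP.
by rewrite -subr_eq0 addrAC subrr sub0r oppr_eq0 => /eqP.
Qed.

(** Test matrices may be conjugated back by [P], since they range over all
    matrices and the characteristic polynomial is a similarity invariant. *)
Lemma add_ffp_compl_setT_conj (R : realType) n (P Q B : 'M[R[i]]_n) :
  P *m Q = 1%:M -> add_ffp_compl setT B -> add_ffp_compl setT (P *m B *m Q).
Proof.
move=> PQ ffpB A _; have := ffpB (Q *m A *m P) I; rewrite /additive_FFP.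
rewrite (char_poly_conj A (mulmx1C PQ)) -[in RHS](char_poly_conj B PQ) => <-.
have -> : A + P *m B *m Q = P *m (Q *m A *m P + B) *m Q.
  by rewrite mulmxDr mulmxDl !mulmxA PQ mul1mx -[A *m P *m Q]mulmxA PQ mulmx1.
exact: char_poly_conj.
Qed.

Lemma add_ffp_compl_setT_scalar (R : realType) n (B : 'M[R[i]]_n) :
  add_ffp_compl setT B -> scalar_matrices R n B.
Proof.
move=> ffpB; have diagB := add_ffp_compl_setT_diag ffpB.
have eq_diag i j : i != j -> B i i = B j j.
  move=> ne_ij; set E : 'M[R[i]]_n := delta_mx i j.
  have EE : E *m E = 0 by rewrite mul_delta_mx_cond (negPf (_ : j != i)) 1?eq_sym.
  (* [E] squares to 0, so [1 - E] is the inverse of [1 + E]; the entry [(i, j)]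
     of the diagonal matrix [(1 + E) B (1 - E)] is [B j j - B i i]. *)
  have PQ : (1%:M + E) *m (1%:M - E) = 1%:M.
    by rewrite mulmxDl !mulmxBr !mulmx1 mul1mx EE subr0 addrNK.
  have := add_ffp_compl_setT_diag (add_ffp_compl_setT_conj PQ ffpB) ne_ij.
  have mulME (M : 'M[R[i]]_n) : (M *m E) i j = M i i.
    rewrite mxE (bigD1 i) //= mxE !eqxx mulr1 big1 ?addr0 // => k /negPf ne_ki.
    by rewrite mxE ne_ki mulr0.
  have mulEM (M : 'M[R[i]]_n) k : (E *m M) i k = M j k.
    rewrite mxE (bigD1 j) //= mxE !eqxx mul1r big1 ?addr0 // => u /negPf ne_uj.
    by rewrite mxE ne_uj andbF mul0r.
  rewrite mulmxBr mulmx1 mulmxDl mul1mx mulmxDl.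
  rewrite [LHS]mxE [X in X + _]mxE [X in _ + X]mxE [X in - X]mxE !mulME !mulEM.
  rewrite (diagB i j) // (diagB j i) 1?eq_sym // add0r addr0 => /eqP.
  by rewrite subr_eq0 eq_sym => /eqP.
case: n B ffpB diagB eq_diag => [|n] B _ diagB eq_diag.
  by exists 0; apply/matrixP => -[].
exists (B ord0 ord0); apply/matrixP => i j; rewrite !mxE.
case: (eqVneq i j) => [<-|/diagB //].
by case: (eqVneq i ord0) => [->|/eq_diag].
Qed.

Theorem theorem4p9 (R : realType) (n : nat) (hn : (1 <= n)%N) :
  additive_FFC_pair (scalar_matrices R n) [set: 'M[R[i]]_n].
Proof.
split; apply/seteqP; split => B.
- by [].
- by move=> _ _ [l ->]; apply: additive_FFP_scalar.
- exact: add_ffp_compl_setT_scalar.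
- by move=> [l ->] A _; apply/additive_FFP_sym/additive_FFP_scalar.
Qed.
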